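(* Let $m\ge1$. For each $\alpha\in[0,m]$, the set $H_\alpha=\{E\in\chi(\mathbb{R}^m):\dim_{\mathcal{H}}E=\alpha\}$ is dense in $\chi(\mathbb{R}^m)$.
   Context: $\chi(\mathbb{R}^m)$ is the collection of all nonempty compact subsets of $\mathbb{R}^m$, equipped with the Hausdorff metric $\mathfrak{H}$ induced by the Euclidean norm. $\dim_{\mathcal{H}}$ denotes Hausdorff dimension. *)

(* Defs.v *)
From HB Require Import structures.
From mathcomp Require Import all_boot all_order all_algebra.
From mathcomp Require Import all_classical all_reals all_analysis.
From mathcomp Require Import ring lra.
Import Order.TTheory GRing.Theory Num.Theory.
Import numFieldNormedType.Exports.

Set Implicit Arguments.
Unset Strict Implicit.
Unset Printing Implicit Defensive.

Local Open Scope classical_set_scope.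
Local Open Scope ring_scope.

(* The norm that the library puts on 'rV[R]_m is the sup norm. It induces the
   same topology as the Euclidean one, so the library's compact is kept, but
   distances and diameters below are taken for the Euclidean norm. *)
Section EuclideanNorm.
Variables (R : realType) (m : nat).
Implicit Types (x y z : 'rV[R]_m).

Definition enorm x : R := Num.sqrt (\sum_(i < m) x ord0 i ^+ 2).

Lemma enorm_ge0 x : 0 <= enorm x.
Proof. exact: sqrtr_ge0. Qed.

Lemma enorm_sqr x : enorm x ^+ 2 = \sum_(i < m) x ord0 i ^+ 2.
Proof. by rewrite sqr_sqrtr // sumr_ge0 // => i _; exact: sqr_ge0. Qed.

Lemma enorm0 : enorm 0 = 0.
Proof. by rewrite /enorm big1 ?sqrtr0 // => i _; rewrite mxE expr0n. Qed.

Lemma enormN x : enorm (- x) = enorm x.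
Proof. by congr Num.sqrt; apply: eq_bigr => i _; rewrite mxE sqrrN. Qed.

Lemma enorm_distC x y : enorm (x - y) = enorm (y - x).
Proof. by rewrite -enormN opprB. Qed.

Lemma coord_le_enorm x i : `|x ord0 i| <= enorm x.
Proof.
rewrite -sqrtr_sqr ler_wsqrtr // (bigD1 i) //= lerDl.
by apply: sumr_ge0 => j _; exact: sqr_ge0.
Qed.

Lemma enorm_eq0 x : enorm x = 0 -> x = 0.
Proof.
move=> x0; apply/rowP => i; rewrite mxE; apply/normr0_eq0/eqP.
by rewrite eq_le normr_ge0 andbT -x0 coord_le_enorm.
Qed.

Lemma enorm_triangle x y : enorm (x + y) <= enorm x + enorm y.
Proof.
have [/enorm_eq0 ->|x0] := eqVneq (enorm x) 0.
  by rewrite enorm0 !add0r.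
have [/enorm_eq0 ->|y0] := eqVneq (enorm y) 0.
  by rewrite enorm0 !addr0.
have xp : 0 < enorm x by rewrite lt0r x0 enorm_ge0.
have yp : 0 < enorm y by rewrite lt0r y0 enorm_ge0.
set s := \sum_(i < m) x ord0 i * y ord0 i.
have sle : s <= enorm x * enorm y.
  have : 0 <= \sum_(i < m) (x ord0 i * enorm y - y ord0 i * enorm x) ^+ 2.
    by apply: sumr_ge0 => i _; exact: sqr_ge0.
  have -> : \sum_(i < m) (x ord0 i * enorm y - y ord0 i * enorm x) ^+ 2 =
      (enorm x * enorm y) * (2 * (enorm x * enorm y - s)).
    under eq_bigr => i _.
      rewrite (_ : _ ^+ 2 = x ord0 i ^+ 2 * enorm y ^+ 2 +
        y ord0 i ^+ 2 * enorm x ^+ 2 +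
        x ord0 i * y ord0 i * (- 2 * enorm x * enorm y)); last by ring.
      over.
    by rewrite !big_split /= -!mulr_suml -!enorm_sqr -/s; ring.
  by rewrite pmulr_rge0 ?mulr_gt0 // pmulr_rge0 // subr_ge0.
rewrite -(ler_pXn2r (n := 2)) ?nnegrE ?addr_ge0 ?enorm_ge0 //.
rewrite enorm_sqr.
under eq_bigr => i _.
  rewrite mxE (_ : _ ^+ 2 = x ord0 i ^+ 2 + y ord0 i ^+ 2 +
    x ord0 i * y ord0 i * 2); last by ring.
  over.
rewrite !big_split /= -!mulr_suml -!enorm_sqr -/s.
rewrite [leRHS](_ : _ = enorm x ^+ 2 + enorm y ^+ 2 + enorm x * enorm y * 2);
  last by ring.
by rewrite lerD2l ler_wpM2r.
Qed.

Lemma enorm_dist_triangle y x z : enorm (x - z) <= enorm (x - y) + enorm (y - z).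
Proof. by rewrite -[x - z](subrKA y) enorm_triangle. Qed.

Lemma compact_enorm_bounded (A : set 'rV[R]_m) :
  compact A -> exists M : R, forall x, A x -> enorm x <= M.
Proof.
move=> /compact_bounded[M [_ /(_ (M + 1))]]; rewrite ltrDl ltr01.
move=> /(_ isT) AM.
exists (Num.sqrt (\sum_(i < m) (M + 1) ^+ 2)) => x /AM /= xM.
rewrite ler_wsqrtr // ler_sum // => i _.
have xi : `|x ord0 i| <= M + 1.
  apply: le_trans xM; rewrite [leRHS](_ : _ = mx_norm x) // mx_normrE.
  exact: (le_bigmax _ (fun ij => `|x ij.1 ij.2|) (ord0, i)).
by rewrite -real_normK ?num_real // lerXn2r // nnegrE (le_trans _ xi).
Qed.

End EuclideanNorm.

Section HausdorffDistance.
Variables (R : realType) (m : nat).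
Implicit Types (x y : 'rV[R]_m) (A B C : set 'rV[R]_m).

Definition point_dist x A : R := inf [set enorm (x - y) | y in A].

Definition hausdorff_dist A B : R :=
  Num.max (sup [set point_dist a B | a in A]) (sup [set point_dist b A | b in B]).

Lemma point_dist_le x A y : A y -> point_dist x A <= enorm (x - y).
Proof.
move=> Ay; apply: ge_inf; last by exists y.
by exists 0 => _ [z _ <-]; exact: enorm_ge0.
Qed.

Lemma le_point_dist x A c : A !=set0 ->
  (forall y, A y -> c <= enorm (x - y)) -> c <= point_dist x A.
Proof.
move=> [y Ay] cA; apply: lb_le_inf; first by exists (enorm (x - y)), y.
by move=> _ [z Az <-]; exact: cA.
Qed.

Lemma point_dist_ge0 x A : A !=set0 -> 0 <= point_dist x A.
Proof. by move=> A0; apply: le_point_dist => // y _; exact: enorm_ge0. Qed.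

Lemma hausdorff_dist_sym A B : hausdorff_dist A B = hausdorff_dist B A.
Proof. exact: maxC. Qed.

Lemma hausdorff_dist_le A B c : A !=set0 -> B !=set0 ->
  (forall a, A a -> point_dist a B <= c) ->
  (forall b, B b -> point_dist b A <= c) -> hausdorff_dist A B <= c.
Proof.
move=> [a Aa] [b Bb] Ac Bc; rewrite ge_max; apply/andP; split; apply: ge_sup.
- by exists (point_dist a B), a.
- by move=> _ [z Az <-]; exact: Ac.
- by exists (point_dist b A), b.
- by move=> _ [z Bz <-]; exact: Bc.
Qed.

Lemma point_dist_le_hausdorff A B a : compact A -> compact B -> B !=set0 ->
  A a -> point_dist a B <= hausdorff_dist A B.
Proof.
move=> cA cB [b Bb] Aa; rewrite le_max; apply/orP; left.
apply: ub_le_sup; last by exists a.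
have [M AM] := compact_enorm_bounded cA.
exists (M + enorm b) => _ [z Az <-].
rewrite (le_trans (point_dist_le z Bb)) //.
by rewrite (le_trans (enorm_triangle _ _)) // enormN lerD2r AM.
Qed.

Lemma point_dist_triangle A B C a :
  compact A -> A !=set0 -> compact B -> B !=set0 -> compact C -> C !=set0 ->
  A a -> point_dist a C <= hausdorff_dist A B + hausdorff_dist B C.
Proof.
move=> cA A0 cB B0 cC C0 Aa; rewrite -lerBlDr.
apply: le_trans (point_dist_le_hausdorff cA cB B0 Aa).
apply: le_point_dist => // b Bb; rewrite lerBlDr.
apply: le_trans (lerD (lexx _) (point_dist_le_hausdorff cB cC C0 Bb)).
rewrite -lerBlDl; apply: le_point_dist => // c Cc; rewrite lerBlDl.
exact: le_trans (point_dist_le a Cc) (enorm_dist_triangle b a c).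
Qed.

Lemma point_dist0_mem A x : compact A -> A !=set0 -> point_dist x A <= 0 -> A x.
Proof.
move=> cA A0 xA; have /closure_id -> : closed A.
  by apply: compact_closed => //; exact: norm_hausdorff.
move=> U /nbhs_ballP[e /= e0 eU].
have [_ [y Ay <-] ye] : exists2 d, [set enorm (x - y) | y in A] d & d < e.
  apply: inf_lt; last exact: le_lt_trans xA e0.
  by case: A0 => y Ay; exists (enorm (x - y)), y.
exists y; split=> //; apply: eU; split=> // i j; rewrite ord1.
apply: le_lt_trans ye.
by have := coord_le_enorm (x - y) j; rewrite !mxE.
Qed.

End HausdorffDistance.

Record hyperspace (R : realType) (m : nat) := Hyperspace {
  hset :> set 'rV[R]_m;
  hset_compact : compact hset;
  hset_nonempty : hset !=set0 }.

HB.instance Definition _ (R : realType) (m : nat) :=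
  gen_eqMixin (hyperspace R m).
HB.instance Definition _ (R : realType) (m : nat) :=
  gen_choiceMixin (hyperspace R m).

Section HausdorffMetric.
Variables (R : realType) (m : nat).
Implicit Types A B C : hyperspace R m.

Lemma hset_inj A B : hset A = hset B -> A = B.
Proof.
case: A B => [A cA A0] [B cB B0] /= AB; subst B.
by congr Hyperspace; exact: Prop_irrelevance.
Qed.

Let hdistxx A : hausdorff_dist A A = 0.
Proof.
have aA a : hset A a -> point_dist a A <= 0.
  by move=> Aa; have := point_dist_le a Aa; rewrite subrr enorm0.
have [a Aa] := hset_nonempty A.
apply/eqP; rewrite eq_le hausdorff_dist_le //; [|by exists a..].
rewrite (le_trans (point_dist_ge0 a (hset_nonempty A))) //.
by apply: point_dist_le_hausdorff => //;
  [exact: hset_compact..|exact: hset_nonempty].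
Qed.

Let hdist_sub A B : hausdorff_dist A B = 0 -> hset A `<=` hset B.
Proof.
move=> AB a Aa; apply: point_dist0_mem;
  [exact: hset_compact|exact: hset_nonempty|].
by rewrite -AB; apply: point_dist_le_hausdorff => //;
  [exact: hset_compact..|exact: hset_nonempty].
Qed.

Let hdist_positivity A B : hausdorff_dist A B = 0 -> A = B.
Proof.
move=> AB; apply: hset_inj; apply/seteqP; split; first exact: hdist_sub.
by apply: hdist_sub; rewrite hausdorff_dist_sym.
Qed.

Let hdist_sym A B : hausdorff_dist A B = hausdorff_dist B A.
Proof. exact: hausdorff_dist_sym. Qed.

Let hdist_triangle B A C :
  hausdorff_dist A C <= hausdorff_dist A B + hausdorff_dist B C.
Proof.
have c := @hset_compact R m; have n := @hset_nonempty R m.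
apply: hausdorff_dist_le => // [a Aa|x Cx].
  exact: (@point_dist_triangle _ _ A B C).
rewrite addrC (hausdorff_dist_sym B) (hausdorff_dist_sym A).
exact: (@point_dist_triangle _ _ C B A).
Qed.

HB.instance Definition _ := isMetric.Build R (hyperspace R m)
  hdistxx hdist_positivity hdist_sym hdist_triangle.

Lemma mdist_hyperspaceE A B : mdist A B = hausdorff_dist A B.
Proof. by []. Qed.

End HausdorffMetric.

Section HausdorffDimension.
Variables (R : realType) (m : nat).
Local Open Scope ereal_scope.
Implicit Types (E U : set 'rV[R]_m) (s delta : R).

(* -oo when U is empty. *)
Definition diameter U : \bar R :=
  ereal_sup [set (enorm (x - y))%:E | x in U & y in U].

(* The conventions are 0 for the empty set and 0^0 = 1 for singletons, so that
   s = 0 gives the counting measure. *)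
Definition diam_pow s U : \bar R :=
  if U == set0 then 0 else diameter U `^ s.

Definition hausdorff_premeasure s delta E : \bar R :=
  ereal_inf [set \sum_(0 <= i <oo) diam_pow s (F i) |
    F in [set F : (set 'rV[R]_m)^nat |
      E `<=` \bigcup_i F i /\ forall i, diameter (F i) <= delta%:E]].

(* The premeasure grows as delta decreases, hence the limit at 0 is a sup. *)
Definition hausdorff_measure s E : \bar R :=
  ereal_sup [set hausdorff_premeasure s delta E | delta in [set d : R | (0 < d)%R]].

Definition hausdorff_dim E : \bar R :=
  ereal_inf [set s%:E | s in [set s : R | (0 <= s)%R /\ hausdorff_measure s E = 0]].

End HausdorffDimension.

(* Main.v *)
(** Given a nonempty compact set A, take a finite eps-net of A and add to it a
    compact set C of dimension alpha close to one point of the net; the finite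
    part does not affect the dimension, and the result is within eps of A.
    For 0 < alpha < m, C is the closure of the image of a map g from [0, 1[ to
    a product of m middle-gap Cantor sets with ratio lam, where
    2^m lam^alpha = 1.  Covering C by the 2^(mn) cubes of generation n bounds
    its dimension above.  Since lam < 1/2, the cubes of a generation are
    separated, hence |t - u| <= c |g t - g u|^alpha; a cover of C then pulls
    back to a cover of [0, 1[ by intervals of length at most a constant times
    diam^alpha, and subadditivity of the Lebesgue measure bounds the dimension
    below.  For alpha = m, C is a cube, which contains such Cantor sets of
    every dimension in ]0, m[.  For alpha = 0, C is empty. *)
Require Import Defs.
From HB Require Import structures.
From mathcomp Require Import all_boot all_order all_algebra.
From mathcomp Require Import all_classical all_reals all_analysis.
From mathcomp Require Import ring lra zify.
Import Order.TTheory GRing.Theory Num.Theory.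
Import numFieldNormedType.Exports.

Set Implicit Arguments.
Unset Strict Implicit.
Unset Printing Implicit Defensive.

Local Open Scope classical_set_scope.
Local Open Scope ring_scope.

(** * Series with coefficients 0 and 1: coordinates of Cantor points *)

Section BitSeries.
Variables (R : realType) (lam : R).
Hypothesis lam01 : 0 < lam < 1.
Implicit Types u v : nat -> bool.

Let lam_gt0 : 0 < lam. Proof. by case/andP: lam01. Qed.

Let lam_lt1 : lam < 1. Proof. by case/andP: lam01. Qed.

Definition bit_sum u : R := limn (series (fun k => lam ^+ k * (u k)%:R)).

Let term_ge0 u k : 0 <= lam ^+ k * (u k)%:R.
Proof. by rewrite mulr_ge0 ?ler0n // exprn_ge0 // ltW. Qed.

Let term_le u k : lam ^+ k * (u k)%:R <= geometric 1 lam k.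
Proof.
rewrite /geometric /= mul1r ler_piMr ?exprn_ge0 ?(ltW lam_gt0) //.
by case: (u k).
Qed.

Lemma is_cvg_bit_sum u : cvgn (series (fun k => lam ^+ k * (u k)%:R)).
Proof.
apply: series_le_cvg (term_ge0 u) _ (term_le u) _.
  by move=> k; rewrite (le_trans (term_ge0 u k)).
by apply: is_cvg_geometric_series; rewrite ger0_norm ?ltW.
Qed.

Lemma bit_sum_ge0 u : 0 <= bit_sum u.
Proof.
by apply: limr_ge; [exact: is_cvg_bit_sum|apply: nearW => n; exact: sumr_ge0].
Qed.

Lemma bit_sum_le u : bit_sum u <= (1 - lam)^-1.
Proof.
have lam1 : `|lam| < 1 by rewrite ger0_norm ?ltW.
have := cvg_geometric_series (a := 1) lam1; rewrite div1r => /cvg_lim <- //.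
apply: ler_lim; [exact: is_cvg_bit_sum|exact: is_cvg_geometric_series|].
by apply: nearW => n; apply: ler_sum => k _; exact: term_le.
Qed.

Lemma bit_sum_recl u :
  bit_sum u = (u 0%N)%:R + lam * bit_sum (fun k => u k.+1).
Proof.
apply/cvg_lim => //; rewrite -(cvg_shiftS (series _)).
rewrite [X in X @ _ --> _](_ : _ =
    (fun n => (u 0%N)%:R + lam * series (fun k => lam ^+ k * (u k.+1)%:R) n)).
  by apply: cvgD; [exact: cvg_cst|apply: cvgMr; exact: is_cvg_bit_sum].
apply/funext => n; rewrite /series /= big_nat_recl // expr0 mul1r mulr_sumr.
by congr (_ + _); apply: eq_bigr => i _; rewrite exprS mulrA.
Qed.

Lemma bit_sum_sub u v n : (forall k, (k < n)%N -> u k = v k) ->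
  bit_sum u - bit_sum v =
  lam ^+ n * (bit_sum (fun k => u (n + k)%N) - bit_sum (fun k => v (n + k)%N)).
Proof.
elim: n u v => [|n IH] u v uv; first by rewrite expr0 mul1r.
rewrite bit_sum_recl [bit_sum v]bit_sum_recl uv // opprD addrACA subrr add0r -mulrBr.
by rewrite (IH (fun k => u k.+1)) 1?exprS ?mulrA // => k kn; exact: uv.
Qed.

Lemma bit_sum_close u v n : (forall k, (k < n)%N -> u k = v k) ->
  `|bit_sum u - bit_sum v| <= lam ^+ n / (1 - lam).
Proof.
move=> /bit_sum_sub ->; rewrite normrM ger0_norm ?exprn_ge0 ?(ltW lam_gt0) //.
rewrite ler_wpM2l ?exprn_ge0 ?(ltW lam_gt0) // ler_norml.
set x := bit_sum _; set y := bit_sum _.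
have := bit_sum_ge0 (fun k => u (n + k)%N); rewrite -/x => x0.
have := bit_sum_ge0 (fun k => v (n + k)%N); rewrite -/y => y0.
have := bit_sum_le (fun k => u (n + k)%N); rewrite -/x => x1.
have := bit_sum_le (fun k => v (n + k)%N); rewrite -/y => y1.
lra.
Qed.

(** After the common prefix cancels, bit [n] contributes [lam ^+ n], and the later bits can take
    back at most [lam ^+ n.+1 / (1 - lam)]. The resulting gap is positive exactly when
    [lam < 1/2]. *)
Lemma bit_sum_far u v n : (forall k, (k < n)%N -> u k = v k) -> u n != v n ->
  lam ^+ n * ((1 - 2 * lam) / (1 - lam)) <= `|bit_sum u - bit_sum v|.
Proof.
wlog un : u v / u n.
  move=> wl uv unv; have [un|un] := boolP (u n); first exact: wl.
  rewrite distrC; apply: wl; last by rewrite eq_sym.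
    by move: unv un; case: (u n); case: (v n).
  by move=> k kn; rewrite uv.
move=> /bit_sum_sub -> unv; have vn : v n = false.
  by move: unv; rewrite un; case: (v n).
rewrite normrM ger0_norm ?exprn_ge0 ?(ltW lam_gt0) //.
rewrite ler_wpM2l ?exprn_ge0 ?(ltW lam_gt0) //.
rewrite (bit_sum_recl (fun k => u _)) (bit_sum_recl (fun k => v _)) addn0 un vn.
set x := bit_sum _; set y := bit_sum _.
have x0 : 0 <= lam * x by rewrite mulr_ge0 ?bit_sum_ge0 // ltW.
have y1 : lam * y <= lam * (1 - lam)^-1.
  by rewrite ler_wpM2l ?bit_sum_le // ltW.
have l1 : 1 - lam != 0 by rewrite subr_eq0 eq_sym lt_eqF.
rewrite (le_trans _ (ler_norm _)) //.
have -> : (1 - 2 * lam) / (1 - lam) = 1 - lam * (1 - lam)^-1 by field.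
rewrite /=; lra.
Qed.

End BitSeries.

(** * Finite covers and vanishing Hausdorff measure *)

Section HausdorffMeasureBounds.
Variables (R : realType) (m : nat).
Implicit Types (A B E U : set 'rV[R]_m) (s e d : R).

Lemma enorm_le_coord (x : 'rV[R]_m) d : 0 <= d ->
  (forall i, `|x ord0 i| <= d) -> enorm x <= Num.sqrt m%:R * d.
Proof.
move=> d0 xd; rewrite -(ler_pXn2r (n := 2)) ?nnegrE ?mulr_ge0 ?sqrtr_ge0 ?enorm_ge0 //.
rewrite enorm_sqr exprMn sqr_sqrtr ?ler0n //.
apply: le_trans (_ : \sum_(i < m) d ^+ 2 <= _).
  apply: ler_sum => i _; rewrite -real_normK ?num_real //.
  by rewrite lerXn2r ?nnegrE.
by rewrite sumr_const card_ord mulr_natl.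
Qed.

Lemma diameter_le U d : (forall x y, U x -> U y -> enorm (x - y) <= d) ->
  (diameter U <= d%:E)%E.
Proof.
move=> Ud; apply: ge_ereal_sup => _ [x Ux [y Uy <-]].
by rewrite lee_fin; exact: Ud.
Qed.

Lemma enorm_le_diameter U x y : U x -> U y ->
  ((enorm (x - y))%:E <= diameter U)%E.
Proof. by move=> Ux Uy; apply: ereal_sup_ubound; exists x => //; exists y. Qed.

Lemma diam_pow_ge0 s U : (0 <= diam_pow s U)%E.
Proof. by rewrite /diam_pow; case: ifP => // _; exact: poweR_ge0. Qed.

Lemma diam_pow_le s U d : 0 <= s -> 0 <= d -> (diameter U <= d%:E)%E ->
  (diam_pow s U <= (d `^ s)%:E)%E.
Proof.
move=> s0 d0 Ud; rewrite /diam_pow; case: eqVneq => [_|/set0P[x Ux]].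
  by rewrite lee_fin powR_ge0.
have U0 : (0 <= diameter U)%E.
  by apply: le_trans (enorm_le_diameter Ux Ux); rewrite lee_fin enorm_ge0.
rewrite -poweR_EFin; apply: gt0_ler_poweR => //;
  by rewrite in_itv /= leey andbT // lee_fin.
Qed.

Lemma powR_enorm_le_diam_pow s U x y : 0 <= s -> U x -> U y ->
  ((enorm (x - y) `^ s)%:E <= diam_pow s U)%E.
Proof.
move=> s0 Ux Uy; rewrite /diam_pow ifF; last by apply/negP=> /eqP U0; rewrite U0 in Ux.
have xyU := enorm_le_diameter Ux Uy.
have xy0 : (0 <= (enorm (x - y))%:E :> \bar R)%E by rewrite lee_fin enorm_ge0.
rewrite -poweR_EFin; apply: gt0_ler_poweR => //;
  by rewrite in_itv /= leey andbT // (le_trans xy0).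
Qed.

(** A single [e] bounds both the diameters and the sum. Finite lists can be concatenated, so this
    property passes to finite unions without any measure theory. *)
Definition finite_cover s e A := exists2 l : seq (set 'rV[R]_m),
  A `<=` \bigcup_(U in [set` l]) U &
  (forall U, U \in l -> (diameter U <= e%:E)%E) /\
  (\sum_(U <- l) diam_pow s U <= e%:E)%E.

Lemma finite_coverU s e d A B : 0 <= e -> 0 <= d ->
  finite_cover s e A -> finite_cover s d B -> finite_cover s (e + d) (A `|` B).
Proof.
move=> e0 d0 [l Al [ldiam lsum]] [k Bk [kdiam ksum]]; exists (l ++ k).
  move=> x [/Al|/Bk] [U /= Ul Ux]; exists U => //=;
    by rewrite mem_cat Ul ?orbT.
split=> [U|]; last by rewrite big_cat EFinD /= leeD.
rewrite mem_cat => /orP[/ldiam|/kdiam] /le_trans; apply; rewrite lee_fin.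
  by rewrite lerDl.
by rewrite lerDr.
Qed.

Lemma finite_cover_seq s e (l : seq 'rV[R]_m) : 0 < s -> 0 <= e ->
  finite_cover s e [set` l].
Proof.
move=> s0 e0.
have diam1 (x : 'rV[R]_m) : (diameter [set x] <= 0%:E)%E.
  by apply: diameter_le => _ _ -> ->; rewrite subrr enorm0.
exists [seq [set x] | x <- l].
  by move=> x /= xl; exists [set x] => //=; apply/mapP; exists x.
split=> [_ /mapP[x _ ->]|]; first by rewrite (le_trans (diam1 x)) // lee_fin.
rewrite big_map big1 ?lee_fin // => x _; apply/eqP.
rewrite eq_le diam_pow_ge0 andbT.
by have := diam_pow_le (ltW s0) (lexx 0) (diam1 x); rewrite powR0 // gt_eqF.
Qed.

(** Generation [n] has at most [M * b ^+ n] pieces, each costing at most [(K * lam ^+ n)]^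
    s[. The total is bounded by a multiple of](b * lam [^ s) ^+ n], so a late enough generation
    serves as the cover. *)
Lemma finite_cover_geometric (I : nat -> finType)
    (F : forall n, I n -> set 'rV[R]_m) (K M b lam s e : R) A :
  0 < lam < 1 -> 0 <= b -> b * lam `^ s < 1 -> 0 <= s -> 0 <= K -> 0 < e ->
  (forall n, #|I n|%:R <= M * b ^+ n) ->
  (forall n, A `<=` \bigcup_i F n i) ->
  (forall n i, (diameter (F n i) <= (K * lam ^+ n)%:E)%E) ->
  finite_cover s e A.
Proof.
move=> /andP[lam0 lam1] b0 blam s0 K0 e0 cardI AF diamF.
have lim0 (C z : R) : 0 <= z < 1 -> C * z ^+ n @[n --> \oo] --> (0 : R).
  move=> /andP[z0 z1]; rewrite -(mulr0 C); apply: cvgMr.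
  by apply: cvg_expr; rewrite ger0_norm.
have : \forall n \near \oo, K * lam ^+ n <= e /\
    M * K `^ s * (b * lam `^ s) ^+ n <= e.
  near=> n; split; near: n.
    apply: (cvgr_le (0 : R)) => //; apply: lim0; by rewrite ltW.
  by apply: (cvgr_le (0 : R)) => //; apply: lim0; rewrite mulr_ge0 ?powR_ge0.
move=> [n _ /(_ n (leqnn n))[Kn Mn]].
exists [seq F n i | i <- enum (I n)].
  move=> x /(AF n)[i _ xi]; exists (F n i) => //=.
  by apply/mapP; exists i => //; rewrite mem_enum.
split=> [_ /mapP[i _ ->]|]; first by rewrite (le_trans (diamF n i)) // lee_fin.
rewrite big_map big_enum /=.
apply: (@le_trans _ _ (\sum_(i : I n) ((K * lam ^+ n) `^ s)%:E)%E).
  apply: lee_sum => i _; apply: diam_pow_le => //.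
  by rewrite mulr_ge0 // exprn_ge0 // ltW.
rewrite sumEFin lee_fin sumr_const -[_ *+ _]mulr_natl; apply: le_trans Mn.
have -> : (K * lam ^+ n) `^ s = K `^ s * (lam `^ s) ^+ n.
  rewrite powRM ?exprn_ge0 ?(ltW lam0) //; congr (_ * _).
  by rewrite -powR_mulrn ?(ltW lam0) // -powRrM mulrC powRrM powR_mulrn ?powR_ge0.
rewrite exprMn mulrCA [leRHS](_ : _ =
  M * b ^+ n * (K `^ s * (lam `^ s) ^+ n)); last by ring.
by rewrite mulrCA ler_wpM2r // mulr_ge0 ?exprn_ge0 ?powR_ge0.
Unshelve. all: by end_near.
Qed.

Lemma hausdorff_measure_eq0 s A : (forall e, 0 < e -> finite_cover s e A) ->
  hausdorff_measure s A = 0%E.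
Proof.
move=> As; apply/eqP; rewrite eq_le; apply/andP; split.
  apply: ge_ereal_sup => _ [d /= d0 <-]; apply/lee_addgt0Pr => e e0.
  rewrite add0e.
  (* The minimum meets both demands: diameters at most [d], sum at most [e]. *)
  have de0 : 0 < Num.min d e by rewrite lt_min d0.
  have [l Al [ldiam lsum]] := As _ de0.
  apply: (@le_trans _ _ (\sum_(U <- l) diam_pow s U)%E); last first.
    by rewrite (le_trans lsum) // lee_fin ge_min lexx orbT.
  (* The list becomes a sequence by padding with empty sets, which have diameter [-oo] and cost
     0. *)
  apply: ereal_inf_lbound; exists (nth set0 l).
    split.
      move=> x /Al[U /= Ul Ux]; exists (index U l) => //.
      by rewrite nth_index.
    move=> i; have [il|il] := ltnP i (size l).
      rewrite (le_trans (ldiam _ (mem_nth _ il))) // lee_fin.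
      by rewrite ge_min lexx.
    by rewrite nth_default // diameter_le.
  rewrite (nneseries_split 0 (size l)) => [|k _]; last exact: diam_pow_ge0.
  rewrite add0n eseries0 ?adde0 => [|k lk _]; last first.
    by rewrite nth_default // /diam_pow eqxx.
  by rewrite (big_nth set0).
apply: (@le_trans _ _ (hausdorff_premeasure s 1 A)).
  apply: le_ereal_inf_tmp => _ [F _ <-].
  by apply: nneseries_ge0 => n _ _; exact: diam_pow_ge0.
by apply: ereal_sup_ubound; exists 1 => //=.
Qed.

End HausdorffMeasureBounds.

(** If [s < alpha], a cover of [E] with small [s]-sum would pull back along [g] to intervals
    covering [[0, 1[] of total length at most 1/2. Only points [g t] need to lie in [E]; [g] need
    not be continuous. *)
Lemma holder_exponent_le (R : realType) (m : nat) (g : R -> 'rV[R]_m)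
    (E : set 'rV[R]_m) (c alpha s : R) :
  0 < c -> (forall t : R, 0 <= t < 1 -> E (g t)) ->
  (forall t u : R, 0 <= t < 1 -> 0 <= u < 1 ->
    `|t - u| <= c * enorm (g t - g u) `^ alpha) ->
  0 <= s -> hausdorff_measure s E = 0%E -> alpha <= s.
Proof.
move=> c0 gE gH s0 Es; rewrite leNgt; apply/negP => salpha.
have alpha0 : 0 < alpha by apply: le_lt_trans salpha.
(* Each interval below has length at most [2 * c] times the cost of its set, so a sum below
   [(4 * c)^-1] gives total length at most 1/2. Taking [delta = 1] keeps all diameters at most 1. *)
have : (hausdorff_premeasure s 1 E < ((4 * c)^-1)%:E)%E.
  apply: (@le_lt_trans _ _ 0%E); last by rewrite lte_fin invr_gt0 mulr_gt0.
  by rewrite -Es; apply: ereal_sup_ubound; exists 1 => //=.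
move=> /ereal_inf_lt[_ [F [EF diamF] <-] sumF].
have diam_pow_fin i : diam_pow s (F i) \is a fin_num.
  rewrite ge0_fin_numE ?diam_pow_ge0 //.
  by rewrite (le_lt_trans (diam_pow_le s0 ler01 (diamF i))) ?ltry.
pose w i := c * fine (diam_pow s (F i)).
pose tau i := xget 0 [set t | 0 <= t < 1 /\ F i (g t)].
pose J i := `[tau i - w i, tau i + w i]%classic.
have w0 i : 0 <= w i by rewrite mulr_ge0 ?(ltW c0) // fine_ge0 // diam_pow_ge0.
have covJ : `[0, 1[%classic `<=` \bigcup_i J i.
  move=> t /=; rewrite in_itv /= => t01; have [i _ Fit] := EF _ (gE t t01).
  exists i => //; have [tau01 Ftau] : 0 <= tau i < 1 /\ F i (g (tau i)).
    by apply: (@xgetPex _ 0 [set t | 0 <= t < 1 /\ F i (g t)]); exists t.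
  rewrite /J /= in_itv /= -ler_distl; apply: le_trans (gH _ _ t01 tau01) _.
  rewrite ler_wpM2l ?(ltW c0) //.
  (* Distances within [F i] are at most 1, so lowering the exponent from [alpha] to [s] increases
     the power. *)
  apply: (@le_trans _ _ (enorm (g t - g (tau i)) `^ s)); last first.
    rewrite -lee_fin fineK ?diam_pow_fin //.
    exact: powR_enorm_le_diam_pow.
  have [->|x0] := eqVneq (enorm (g t - g (tau i))) 0.
    by rewrite powR0 ?powR_ge0 // gt_eqF.
  apply: ger_powR; last exact: ltW.
  rewrite lt0r x0 enorm_ge0 /= -lee_fin.
  by rewrite (le_trans (enorm_le_diameter Fit Ftau)) // diamF.
have measJ i : measurable (J i : set R) by exact: measurable_itv.
have le1 : (1 <= \sum_(0 <= i <oo) lebesgue_measure (J i : set R))%E.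
  have -> : 1%E = lebesgue_measure (`[0, 1[%classic : set R).
    by rewrite lebesgue_measure_itv /= lte_fin ltr01 oppr0 adde0.
  apply: (@measure_sigma_subadditive _ _ _ (@lebesgue_measure R)) covJ => //=.
have lenJ i : (lebesgue_measure (J i : set R) <=
    (2 * c)%:E * diam_pow s (F i))%E.
  rewrite lebesgue_measure_itv /= -(fineK (diam_pow_fin i)) -EFinM.
  have -> : 2 * c * fine (diam_pow s (F i)) = 2 * w i by rewrite /w; ring.
  case: ifP => _; last by rewrite lee_fin mulr_ge0.
  by rewrite -EFinB lee_fin; lra.
have : (1 < 1 :> \bar R)%E; last by rewrite ltxx.
apply: le_lt_trans le1 _.
apply: (@le_lt_trans _ _ ((2 * c)%:E * (4 * c)^-1%:E)%E).
  apply: (@le_trans _ _ (\sum_(0 <= i <oo) (2 * c)%:E * diam_pow s (F i))%E).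
    exact: lee_nneseries.
  rewrite nneseriesZl => [|i _]; last exact: diam_pow_ge0.
  by rewrite lee_pmul2l ?ltW // lte_fin mulr_gt0.
rewrite -EFinM lte_fin.
have -> : 2 * c * (4 * c)^-1 = 2^-1 by field; rewrite gt_eqF.
by rewrite invf_lt1 // ltr1n.
Qed.

(** Used to turn a difference between two base-[2 ^ m] digits into a difference of one bit, hence of
    one coordinate. The induction strips off the lowest bit. *)
Lemma eq_mod_exp2 m x y :
  (forall j, (j < m)%N -> odd (x %/ 2 ^ j) = odd (y %/ 2 ^ j)) ->
  x = y %[mod 2 ^ m].
Proof.
elim: m x y => [|m IH] x y xy; first by rewrite expn0 !modn1.
have h z : (z %% 2 ^ m.+1 = odd z + 2 * (z./2 %% 2 ^ m))%N.
  have zlt : (z./2 %% 2 ^ m < 2 ^ m)%N by rewrite ltn_mod expn_gt0.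
  rewrite -{1}(odd_double_half z) {1}(divn_eq z./2 (2 ^ m)) -mul2n mulnDr.
  rewrite mulnCA -expnS addnCA modnMDl modn_small // expnS.
  by case: (odd z); lia.
rewrite !h; congr (_ + 2 * _)%N; first by have := xy 0%N isT; rewrite !divn1 => ->.
apply: IH => j jm; rewrite -!divn2 -!divnMA -expnS; exact: xy.
Qed.

(** * The Cantor set parametrised by base-[2 ^ m] digits *)

Section DyadicCantor.
Variables (R : realType) (m : nat) (lam r : R) (p : 'rV[R]_m).
Hypothesis m_gt0 : (0 < m)%N.
Hypothesis lam01 : 0 < lam < 1.
Hypothesis r_gt0 : 0 < r.

Implicit Types t u : R.

Let b := (2 ^ m)%N.

(* The base-2^m digits of t are read as m bits each; the j-th bits drive the
   j-th coordinate, so code n t names the generation-n cube containing the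
   point with parameter t. *)
Definition code n (t : R) : nat := Num.truncn (b%:R ^+ n * t).

(** No reduction modulo [2 ^ m] is made: for [j < m], bit [j] of the whole code is already bit [j]
    of its last digit. *)
Definition code_bit (t : R) (j k : nat) : bool := odd (code k.+1 t %/ 2 ^ j).

Definition cantor_point (t : R) : 'rV[R]_m :=
  p + r *: \row_(j < m) bit_sum lam (code_bit t j).

Let b_gt0 : 0 < b%:R :> R. Proof. by rewrite ltr0n expn_gt0. Qed.

(** Dividing by [b] drops the last digit; this is what makes the cubes of successive generations
    nested. *)
Lemma code_div n t : 0 <= t -> (code n.+1 t %/ b = code n t)%N.
Proof.
move=> t0; have c0 k : 0 <= b%:R ^+ k * t by rewrite mulr_ge0 ?exprn_ge0 ?(ltW b_gt0).
have /andP[n1 n2] := truncn_itv (c0 n); have /andP[s1 s2] := truncn_itv (c0 n.+1).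
apply/eqP; rewrite eqn_leq -ltnS ltn_divLR ?leq_divRL ?expn_gt0 //.
apply/andP; split.
  rewrite -(ltr_nat R) natrM (le_lt_trans s1) // exprS -mulrA mulrC.
  by rewrite ltr_pM2r.
rewrite -ltnS -(ltr_nat R) natrM (le_lt_trans _ s2) // exprS -mulrA.
by rewrite [leLHS]mulrC ler_pM2l.
Qed.

Lemma code_eq_le n k t u : 0 <= t -> 0 <= u -> code n t = code n u ->
  (k <= n)%N -> code k t = code k u.
Proof.
move=> t0 u0; elim: n => [|n IH] tu; first by rewrite leqn0 => /eqP ->.
rewrite leq_eqVlt => /orP[/eqP ->//|]; rewrite ltnS; apply: IH.
by rewrite -(code_div n t0) -(code_div n u0) tu.
Qed.

Lemma code_eq_dist n t u : 0 <= t -> 0 <= u -> code n t = code n u ->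
  `|t - u| <= (b%:R ^+ n)^-1.
Proof.
move=> t0 u0 tu.
have c0 (v : R) : 0 <= v -> 0 <= b%:R ^+ n * v.
  by move=> ?; rewrite mulr_ge0 ?exprn_ge0 ?(ltW b_gt0).
have /andP[t1 t2] := truncn_itv (c0 _ t0); have /andP[u1 u2] := truncn_itv (c0 _ u0).
have bn0 : 0 < b%:R ^+ n :> R by rewrite exprn_gt0.
rewrite -(ler_pM2l bn0) divff ?gt_eqF // -[X in X * _](gtr0_norm bn0) -normrM mulrBr.
move: t1 t2 u1 u2; rewrite -/(code n t) -/(code n u) tu -natr1.
set z := (code n u)%:R => *; rewrite ler_norml; lra.
Qed.

Lemma code_lt n t : 0 <= t < 1 -> (code n t < b ^ n)%N.
Proof.
move=> /andP[t0 t1]; rewrite truncn_lt_nat ?mulr_ge0 ?exprn_ge0 ?(ltW b_gt0) //.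
by rewrite natrX gtr_pMr // exprn_gt0.
Qed.

Lemma cantor_point_coord t u (j : 'I_m) :
  (cantor_point t - cantor_point u) ord0 j =
  r * (bit_sum lam (code_bit t j) - bit_sum lam (code_bit u j)).
Proof. by rewrite !mxE opprD addrACA subrr add0r mulrBr. Qed.

Lemma code_eq_cantor_point n t u (j : 'I_m) : 0 <= t -> 0 <= u ->
  code n t = code n u ->
  `|(cantor_point t - cantor_point u) ord0 j| <= r * (lam ^+ n / (1 - lam)).
Proof.
move=> t0 u0 tu; rewrite cantor_point_coord normrM gtr0_norm // ler_pM2l //.
apply: bit_sum_close => // k kn; rewrite /code_bit.
by rewrite (code_eq_le t0 u0 tu).
Qed.

Lemma cantor_point_far n t u : 0 <= t -> 0 <= u ->
  code n t = code n u -> code n.+1 t != code n.+1 u ->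
  r * (lam ^+ n * ((1 - 2 * lam) / (1 - lam))) <=
  enorm (cantor_point t - cantor_point u).
Proof.
move=> t0 u0 tu tu1.
(* The codes agree up to generation [n], so they differ in the last digit, hence in one of its [m]
   bits. *)
have [j bj] : exists j : 'I_m, code_bit t j n != code_bit u j n.
  apply: contrapT => nj; move/eqP: tu1; apply.
  rewrite (divn_eq (code n.+1 t) b) (divn_eq (code n.+1 u) b) !code_div // tu.
  congr addn; apply: eq_mod_exp2 => j jm; apply/eqP/negPn/negP => bj.
  by apply: nj; exists (Ordinal jm).
apply: le_trans (coord_le_enorm _ j).
rewrite cantor_point_coord normrM gtr0_norm // ler_pM2l //.
apply: bit_sum_far => // k kn; rewrite /code_bit.
by rewrite (code_eq_le t0 u0 tu).
Qed.

Lemma cantor_point_holder (alpha : R) :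
  lam < 2^-1 -> lam `^ alpha = b%:R^-1 -> 0 < alpha ->
  exists2 c, 0 < c & forall t u : R, 0 <= t < 1 -> 0 <= u < 1 ->
  `|t - u| <= c * enorm (cantor_point t - cantor_point u) `^ alpha.
Proof.
move=> lam2 lama alpha0; have /andP[lam0 lam1] := lam01.
set kap := r * ((1 - 2 * lam) / (1 - lam)).
have kap0 : 0 < kap by rewrite mulr_gt0 // divr_gt0; lra.
have ka0 : 0 < kap `^ alpha by rewrite powR_gt0.
exists (kap `^ alpha)^-1; first by rewrite invr_gt0.
move=> t u /andP[t0 t1] /andP[u0 u1].
rewrite -ler_pdivrMl ?invr_gt0 // invrK.
have [->|tu] := eqVneq t u; first by rewrite subrr normr0 mulr0 powR_ge0.
have d0 : 0 < `|t - u| by rewrite normr_gt0 subr_eq0.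
(* Codes equal at every generation would give [|t - u| <= b ^- n.+1] for all [n], although
   [b ^ n.+1] exceeds [n.+1] and so eventually [|t - u|^-1]. *)
have [N NP] : exists n, code n.+1 t != code n.+1 u.
  apply: contrapT => tueq.
  have [n dn] : exists n : nat, `|t - u|^-1 < n.+1%:R.
    by exists (Num.truncn `|t - u|^-1); exact: truncnS_gt.
  have ceq : code n.+1 t = code n.+1 u.
    by apply/eqP/negPn/negP => neq; apply: tueq; exists n.
  have := code_eq_dist t0 u0 ceq.
  rewrite -[leLHS]invrK lef_pV2 ?posrE ?exprn_gt0 ?invr_gt0 // => bn.
  have := le_lt_trans bn dn; rewrite -natrX ltr_nat ltnNge ltnW //.
  by apply: ltn_expl; rewrite -{1}(expn0 2) ltn_exp2l.
have := ex_minnP (ex_intro (fun n => code n.+1 t != code n.+1 u) N NP).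
move=> [n nP nmin].
have ceq : code n t = code n u.
  (* For positive [n] this is minimality; at generation 0 both codes are 0 because the parameters
     are below 1. *)
  case: n nP nmin => [|n] _ nmin.
    have c0 (v : R) : 0 <= v < 1 -> code 0 v = 0%N by move=> /(code_lt 0); case: code.
    by rewrite !c0 // ?t0 ?u0.
  by apply/eqP/negPn/negP => /nmin; rewrite ltnn.
have far := cantor_point_far t0 u0 ceq nP.
apply: (@le_trans _ _ ((kap * lam ^+ n) `^ alpha)); last first.
  apply: ge0_ler_powR; rewrite ?nnegrE ?enorm_ge0 ?(ltW alpha0) //.
    by rewrite mulr_ge0 ?exprn_ge0 ?ltW.
  apply: le_trans far; rewrite /kap le_eqVlt; apply/orP; left; apply/eqP; ring.
rewrite powRM ?exprn_ge0 ?(ltW kap0) ?(ltW lam0) // ler_pM2l //.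
rewrite -powR_mulrn ?(ltW lam0) // -powRrM mulrC powRrM powR_mulrn ?powR_ge0 //.
by rewrite lama exprVn; exact: code_eq_dist.
Qed.

End DyadicCantor.

Lemma powR_lt1 (R : realType) (x s : R) : 0 <= x < 1 -> 0 < s -> x `^ s < 1.
Proof.
move=> /andP[x0 x1] s0; rewrite -[ltRHS](_ : 1 `^ s = 1); last by rewrite powR1.
by apply: gt0_ltr_powR; rewrite ?nnegrE.
Qed.

(** * Cubes and the upper bound on their dimension *)

Section Boxes.
Variables (R : realType) (m : nat).
Implicit Types (p : 'rV[R]_m) (rho : R).

Definition box p rho : set 'rV[R]_m :=
  [set y | forall j, `|y ord0 j - p ord0 j| <= rho].

Lemma box_compact p rho : compact (box p rho).
Proof.
rewrite (_ : box p rho = [set y : 'rV[R]_m | forall j,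
    `[p ord0 j - rho, p ord0 j + rho]%classic (y ord0 j)]).
  apply: (@rV_compact R m (fun j => `[p ord0 j - rho, p ord0 j + rho]%classic)).
  by move=> j; exact: segment_compact.
by apply/seteqP; split=> y yp j; have := yp j; rewrite /= in_itv /= ler_distl.
Qed.

Lemma box_closed p rho : closed (box p rho).
Proof. by apply: compact_closed; [exact: norm_hausdorff|exact: box_compact]. Qed.

Lemma diameter_box p rho : 0 <= rho ->
  (diameter (box p rho) <= (Num.sqrt m%:R * (2 * rho))%:E)%E.
Proof.
move=> rho0; apply: diameter_le => x y xp yp.
apply: enorm_le_coord => [|j]; first by rewrite mulr_ge0.
rewrite !mxE -[_ - _](subrKA (p ord0 j)) (le_trans (ler_normD _ _)) //.
by rewrite mulr2n mulrDl mul1r lerD // distrC.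
Qed.

Lemma half_powR_lt1 (s : R) : m%:R < s -> (2 ^ m)%:R * 2^-1 `^ s < 1 :> R.
Proof.
move=> ms; have h0 : 0 < 2^-1 :> R by rewrite invr_gt0.
rewrite -(subrK m%:R s) powRD ?(gt_eqF h0) ?implybT // powR_mulrn ?ltW //.
rewrite mulrCA natrX exprVn divff ?expf_neq0 // mulr1.
by apply: powR_lt1; rewrite ?subr_gt0 // ltW //= invf_lt1 ?ltr1n.
Qed.

Lemma finite_cover_box p rho s e : 0 < rho -> m%:R < s -> 0 < e ->
  finite_cover s e (box p rho).
Proof.
move=> rho0 ms e0.
(* There are [2 ^ n + 1] grid positions per coordinate, so that the right end of the side, where the
   truncation equals [2 ^ n], also has an index. Their number is at most [2 ^ m] times
   [(2 ^ m) ^ n], whence the constant [2 ^+ m] below. *)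
pose I n := {ffun 'I_m -> 'I_(2 ^ n).+1}.
pose F n (v : I n) := box (\row_j (p ord0 j - rho + 2 * rho * ((v j)%:R / 2 ^+ n)))
  (2 * rho * 2^-1 ^+ n).
have s0 : 0 <= s by rewrite (le_trans _ (ltW ms)).
apply: (@finite_cover_geometric _ _ I F (Num.sqrt m%:R * (2 * (2 * rho)))
  (2 ^+ m) (2 ^ m)%:R 2^-1) => //.
- by rewrite invr_gt0 ltr0n invf_lt1 ?ltr1n.
- exact: half_powR_lt1.
- by rewrite mulr_ge0 // ?sqrtr_ge0 // !mulr_ge0 // ltW.
- move=> n; rewrite card_ffun !card_ord -!natrX -natrM ler_nat.
  rewrite -(expnM 2 m n) (mulnC m n) expnM -expnMn.
  have [m0|m0] := posnP m; first by rewrite m0 !expn0.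
  rewrite leq_exp2r //.
  by rewrite mul2n -addnn -addn1 leq_add2l expn_gt0.
- move=> n y yp.
  (* The coordinate rescaled to [[0, 1]]; its truncation at scale [2 ^+ n] selects the grid
     position. *)
  pose x j := (y ord0 j - p ord0 j + rho) / (2 * rho).
  have rr0 : 0 < 2 * rho by rewrite mulr_gt0.
  have x01 j : 0 <= x j <= 1.
    have := yp j; rewrite ler_norml => /andP[y1 y2].
    by rewrite divr_ge0 ?ler_pdivrMr ?(ltW rr0) //; lra.
  have nx0 j : 0 <= 2 ^+ n * x j by rewrite mulr_ge0 // (andP (x01 j)).1.
  have ltk j : (Num.truncn (2 ^+ n * x j) < (2 ^ n).+1)%N.
    rewrite truncn_lt_nat // -[(2 ^ n).+1%:R]natr1 natrX.
    rewrite (@le_lt_trans _ _ (2 ^+ n)) ?ltrDl //.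
    by rewrite ler_piMr ?exprn_ge0 // (andP (x01 j)).2.
  exists [ffun j => Ordinal (ltk j)] => // j; rewrite mxE ffunE /=.
  have /andP[k1 k2] := truncn_itv (nx0 j).
  have -> : y ord0 j = p ord0 j - rho + 2 * rho * x j.
    by rewrite /x; field; rewrite gt_eqF.
  rewrite opprD addrACA subrr add0r -mulrBr normrM gtr0_norm // ler_pM2l //.
  have n0 : 0 < 2 ^+ n :> R by rewrite exprn_gt0.
  rewrite exprVn -[leRHS]mulr1 ler_pdivlMl // -[X in X * _](gtr0_norm n0).
  rewrite -normrM mulrBr [2 ^+ n * (_ / 2 ^+ n)]mulrC divfK ?gt_eqF // ler_norml.
  by move: k1 k2; rewrite -[_.+1%:R]natr1; lra.
- move=> n v; apply: le_trans (diameter_box _ _) _.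
    by rewrite mulr_ge0 ?exprn_ge0 // mulr_ge0 // ltW.
  by rewrite lee_fin -!mulrA.
Qed.

End Boxes.

(** * Cantor sets of prescribed dimension inside a cube *)

Section CantorSets.
Variables (R : realType) (m : nat).
Hypothesis m_gt0 : (0 < m)%N.
Implicit Types (p : 'rV[R]_m) (alpha rho : R).

Let b : R := (2 ^ m)%:R.

(* The solution of 2 ^ m * lam `^ alpha = 1: each cube of the construction
   contains 2 ^ m cubes scaled by lam. *)
Definition cantor_ratio alpha : R := 2^-1 `^ (m%:R / alpha).

Lemma cantor_ratio_powR alpha : 0 < alpha -> cantor_ratio alpha `^ alpha = b^-1.
Proof.
move=> a0; rewrite -powRrM divfK ?gt_eqF // powR_mulrn ?invr_ge0 //.
by rewrite exprVn /b natrX.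
Qed.

Lemma cantor_ratio_gt0 alpha : 0 < cantor_ratio alpha.
Proof. by rewrite powR_gt0 // invr_gt0. Qed.

Lemma cantor_ratio_lt alpha : 0 < alpha < m%:R -> cantor_ratio alpha < 2^-1.
Proof.
move=> /andP[a0 am]; have h0 : 0 < 2^-1 :> R by rewrite invr_gt0.
rewrite /cantor_ratio -(subrK 1 (m%:R / alpha)) powRD ?(gt_eqF h0) ?implybT //.
rewrite powRr1 ?(ltW h0) // gtr_pMl //; apply: powR_lt1.
  by rewrite ltW //= invf_lt1 ?ltr1n.
by rewrite subr_gt0 ltr_pdivlMr // mul1r.
Qed.

Lemma cantor_ratio_lt01 alpha : 0 < alpha < m%:R -> 0 < cantor_ratio alpha < 1.
Proof. by move=> /cantor_ratio_lt am; have := cantor_ratio_gt0 alpha; lra. Qed.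

(** For [0 < alpha < m] the ratio is below 1/2, so bit sums are at most 2 and the scale [rho / 2]
    keeps the set in [box p rho]. *)
Definition cantor alpha rho p : R -> 'rV[R]_m :=
  cantor_point (cantor_ratio alpha) (rho / 2) p.

Lemma cantor_in_box alpha rho p t : 0 < alpha < m%:R -> 0 < rho ->
  box p rho (cantor alpha rho p t).
Proof.
move=> am rho0 j; rewrite !mxE addrAC subrr add0r.
have lam01 := cantor_ratio_lt01 am; have lam2 := cantor_ratio_lt am.
have x0 := bit_sum_ge0 lam01 (code_bit m t j).
have x1 := bit_sum_le lam01 (code_bit m t j).
rewrite ger0_norm ?mulr_ge0 ?divr_ge0 ?(ltW rho0) //.
rewrite -[leRHS](divfK (x := 2)) // ler_pM2l ?divr_gt0 //.
apply: le_trans x1 _; rewrite -[leRHS]invrK lef_pV2 ?posrE ?invr_gt0 //; lra.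
Qed.

Lemma cantor_dim_ge alpha rho p (E : set 'rV[R]_m) (s : R) :
  0 < alpha < m%:R -> 0 < rho ->
  (forall t : R, 0 <= t < 1 -> E (cantor alpha rho p t)) ->
  0 <= s -> hausdorff_measure s E = 0%E -> alpha <= s.
Proof.
move=> am rho0 EC s0 Es; have rho2 : 0 < rho / 2 by rewrite divr_gt0.
have a0 : 0 < alpha by case/andP: am.
have [c c0 cH] := cantor_point_holder p m_gt0 (cantor_ratio_lt01 am) rho2
  (cantor_ratio_lt am) (cantor_ratio_powR a0) a0.
exact: holder_exponent_le c0 EC cH s0 Es.
Qed.

Lemma finite_cover_cantor alpha rho p s e :
  0 < alpha < m%:R -> 0 < rho -> alpha < s -> 0 < e ->
  finite_cover s e (closure [set cantor alpha rho p t | t in `[0, 1[]).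
Proof.
move=> am rho0 als e0; have rho2 : 0 < rho / 2 by rewrite divr_gt0.
have a0 : 0 < alpha by case/andP: am.
have lam01 := cantor_ratio_lt01 am; set lam := cantor_ratio alpha in lam01 *.
have /andP[lam0 lam1] := lam01.
have b0 : 0 < b by rewrite ltr0n expn_gt0.
(* The number [k / b ^+ n] has generation-[n] code [k], so it represents all parameters with that
   code. The radius is the bound of [code_eq_cantor_point]. *)
pose F n (k : 'I_((2 ^ m) ^ n)) :=
  box (cantor alpha rho p (k%:R / b ^+ n)) (rho / 2 * (lam ^+ n / (1 - lam))).
have K0 n : 0 <= rho / 2 * (lam ^+ n / (1 - lam)).
  by rewrite mulr_ge0 ?(ltW rho2) // divr_ge0 ?exprn_ge0 ?subr_ge0 ?ltW.
have s0 : 0 < s by apply: lt_trans als.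
apply: (@finite_cover_geometric _ _ (fun n => 'I_((2 ^ m) ^ n)) F
  (Num.sqrt m%:R * (2 * (rho / 2 * (1 - lam)^-1))) 1 b lam) => //.
- rewrite -(subrK alpha s) powRD ?(gt_eqF lam0) ?implybT // cantor_ratio_powR //.
  rewrite mulrCA divff ?gt_eqF // mulr1; apply: powR_lt1.
    by rewrite lam1 ltW.
  by rewrite subr_gt0.
- exact: ltW.
- rewrite mulr_ge0 ?sqrtr_ge0 // mulr_ge0 // mulr_ge0 ?(ltW rho2) //.
  by rewrite invr_ge0 subr_ge0 ltW.
- by move=> n; rewrite card_ord mul1r /b -natrX.
(* A finite union of closed boxes is closed, so covering the image covers its closure. *)
- move=> n; have /closure_id -> : closed (\bigcup_i F n i).
    by apply: closed_bigcup => [|i _]; [exact: finite_finset|exact: box_closed].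
  apply: closure_subset => _ [t /= t01 <-]; rewrite in_itv /= in t01.
  exists (Ordinal (code_lt m n t01)) => // j /=.
  have /andP[t0 _] := t01.
  have u0 : 0 <= (code m n t)%:R / b ^+ n by rewrite divr_ge0 ?exprn_ge0 ?(ltW b0).
  have tu : code m n t = code m n ((code m n t)%:R / b ^+ n).
    by rewrite [RHS]/code mulrC divfK ?natrK // expf_neq0 // gt_eqF.
  have := code_eq_cantor_point p lam01 rho2 j t0 u0 tu.
  by rewrite mxE [X in _ + X]mxE.
- move=> n k; apply: le_trans (diameter_box _ (K0 n)) _.
  by rewrite lee_fin le_eqVlt; apply/orP; left; apply/eqP; ring.
Qed.

End CantorSets.

(** The last two clauses replace a statement about the dimension of [C] by what survives adding a
    finite net: finite covers can be joined, and the lower bound holds for every superset. *)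
Lemma exists_compact_of_dim (R : realType) (m : nat) (p : 'rV[R]_m) (alpha rho : R) :
  (0 < m)%N -> 0 <= alpha <= m%:R -> 0 < rho ->
  exists C : set 'rV[R]_m, [/\ compact C, C `<=` box p rho,
    forall s e, alpha < s -> 0 < e -> finite_cover s e C &
    forall E s, C `<=` E -> 0 <= s -> hausdorff_measure s E = 0%E -> alpha <= s].
Proof.
move=> m0 /andP[a0 am] rho0.
have [->|ne0] := eqVneq alpha 0.
  (* For [alpha = 0] the lower bound is just [0 <= s], and the nonempty net will make up the whole
     set. *)
  exists set0; split=> //; first exact: compact0.
  move=> s e s0 e0; exists [::]; first by [].
  by split=> //; rewrite big_nil lee_fin ltW.
have [->|nem] := eqVneq alpha m%:R.
  exists (box p rho); split=> //; first exact: box_compact.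
    by move=> s e ms e0; exact: finite_cover_box.
  move=> E s bE s0 Es; rewrite leNgt; apply/negP => sm.
  (* The box contains a Cantor set whose exponent is the midpoint of [s] and [m], which forces this
     midpoint to be at most [s]. *)
  have bm : 0 < (s + m%:R) / 2 < m%:R by lra.
  have : (s + m%:R) / 2 <= s; last by lra.
  apply: (cantor_dim_ge (p := p) m0 bm rho0) s0 Es => t _.
  by apply: bE; exact: cantor_in_box.
have am' : 0 < alpha < m%:R by rewrite lt0r ne0 a0 lt_neqAle nem.
have CB : closure [set cantor alpha rho p t | t in `[0, 1[] `<=` box p rho.
  have /closure_id -> : closed (box p rho) by exact: box_closed.
  by apply: closure_subset => _ [t _ <-]; exact: cantor_in_box.
exists (closure [set cantor alpha rho p t | t in `[0, 1[]); split=> //.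
- by apply: subclosed_compact CB; [exact: closed_closure|exact: box_compact].
- by move=> s e als e0; exact: finite_cover_cantor.
- move=> E s CE s0 Es; apply: (cantor_dim_ge (p := p) m0 am' rho0) s0 Es.
  by move=> t t01; apply: CE; apply: subset_closure; exists t.
Qed.

(** * Finite nets and density *)

Lemma compact_finite_net (R : realType) (m : nat) (A : set 'rV[R]_m) (e : R) :
  compact A -> 0 < e -> exists2 l : seq 'rV[R]_m, [set` l] `<=` A &
  forall a, A a -> exists2 x, x \in l & box x e a.
Proof.
rewrite compact_cover => cA e0.
have [||D DA AD] := cA 'rV[R]_m A (fun x => (ball x e)^°).
- by move=> x _; exact: open_interior.
- by move=> x Ax; exists x => //; exact: nbhsx_ballx.
exists (finmap.enum_fset D); first by move=> x /= /DA; rewrite inE.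
move=> a /AD[x /= xD /interior_subset[_ xa]]; exists x => // j.
by have := xa ord0 j; rewrite /ball /= distrC => /ltW.
Qed.

Theorem theorem3p11 (R : realType) (m : nat) (hm : (1 <= m)%N)
    (alpha : R) (halpha : 0 <= alpha <= m%:R) :
  dense [set E : hyperspace R m | hausdorff_dim E = alpha%:E].
Proof.
move=> O [A OA] Oopen.
have := open_nbhs_nbhs (conj Oopen OA); move=> /nbhs_ballP[e /= e0 eO].
(* The factor [Num.sqrt m%:R] converts coordinatewise bounds to Euclidean ones. Halving [e] leaves
   room for the strict inequality of the open ball. *)
pose rho := e / 2 / Num.sqrt m%:R.
have sm0 : 0 < Num.sqrt m%:R :> R by rewrite sqrtr_gt0 ltr0n.
have rho0 : 0 < rho by rewrite !divr_gt0.
have box_near (x y : 'rV[R]_m) : box x rho y -> enorm (y - x) <= e / 2.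
  move=> xy; have -> : e / 2 = Num.sqrt m%:R * rho.
    by rewrite /rho [RHS]mulrC divfK // gt_eqF.
  by apply: enorm_le_coord => [|j]; [exact: ltW|rewrite !mxE; exact: xy].
have [l lA Al] := compact_finite_net (@hset_compact _ _ A) rho0.
have [a0 Aa0] := @hset_nonempty _ _ A.
have [p pl _] := Al _ Aa0.
have [C [cC Cp Cupper Clower]] := exists_compact_of_dim p hm halpha rho0.
have cE : compact ([set` l] `|` C).
  by apply: compactU => //; apply: finite_compact; exact: finite_seq.
have nE : ([set` l] `|` C) !=set0 by exists p; left.
exists (Hyperspace cE nE); split.
  apply: eO; rewrite ballEmdist /= mdist_hyperspaceE.
  apply: (@le_lt_trans _ _ (e / 2)); last by rewrite ltr_pdivrMr // ltr_pMr // ltr1n.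
  apply: hausdorff_dist_le => //=; first by exists a0.
    move=> a /Al[x xl ax].
    by apply: le_trans (point_dist_le (y := x) _ _) (box_near _ _ ax); left.
  move=> y [yl|Cy].
    apply: le_trans (point_dist_le _ (lA _ yl)) _.
    by rewrite subrr enorm0 divr_ge0 // ltW.
  (* All of [C] is close to the single net point [p], which belongs to [A]. *)
  by apply: le_trans (point_dist_le _ (lA _ pl)) _; apply: box_near; exact: Cp.
have /andP[alpha0 _] := halpha.
apply/eqP; rewrite eq_le; apply/andP; split; last first.
  apply: le_ereal_inf_tmp => _ [s [s0 Es] <-]; rewrite lee_fin.
  by apply: Clower Es => //= x; right.
(* The exponent [alpha + d] is positive even when [alpha = 0], so the finite net is null for it. *)
apply/lee_addgt0Pr => d d0; apply: ereal_inf_lbound; exists (alpha + d) => //.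
split; first by rewrite addr_ge0 // ltW.
apply: hausdorff_measure_eq0 => r r0; rewrite (splitr r).
apply: finite_coverU; rewrite ?divr_ge0 ?(ltW r0) //.
  by apply: finite_cover_seq; [rewrite ltr_wpDl|rewrite divr_ge0 ?ltW].
by apply: Cupper; rewrite ?ltrDl ?divr_gt0.
Qed.
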